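(* Let $\Upsilon\in\bigodot^3\mathbb{R}^5$ be the standard tensor. The orbit of $\Upsilon_{ijk}$ under the action of $\mathbf{O}(5)$ on $\bigodot^3\mathbb{R}^5$ consists of all tensors $\Psi_{ijk}$ for which the associated linear map $$\mathbb{R}^5\ni v\mapsto \Psi_v\in\mathrm{End}(\mathbb{R}^5),\qquad (\Psi_v)_{ij}=\Psi_{ijk}v_k,$$ satisfies the following three conditions: (1) it is totally symmetric, i.e. $g(u,\Psi_v w)=g(w,\Psi_v u)=g(u,\Psi_w v)$ for all $u,v,w\in\mathbb{R}^5$; (2) it is trace free, $\mathrm{tr}(\Psi_v)=0$ for all $v\in\mathbb{R}^5$; (3) for any vector $v\in\mathbb{R}^5$, $\Psi_v^2v=g(v,v)\,v$.
   Context: $g$ is the standard Euclidean scalar product on $\mathbb{R}^5$; repeated indices are summed and upper and lower indices are not distinguished. The standard tensor $\Upsilon_{ijk}$ is the totally symmetric tensor with $\Upsilon_{ijk}a^ia^ja^k=\Upsilon(a,a,a)$, where $$\Upsilon(a,a,a)=\tfrac12a_1(6a_2^2+6a_4^2-2a_1^2-3a_3^2-3a_5^2)+\tfrac{3\sqrt3}{2}a_4(a_5^2-a_3^2)+3\sqrt3\,a_2a_3a_5.$$ The group $\mathbf{O}(5)$ acts on $\bigodot^3\mathbb{R}^5$ by $\Upsilon_{ijk}\mapsto H^l{}_iH^m{}_jH^n{}_k\Upsilon_{lmn}$, $H\in\mathbf{O}(5)$. *)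

(* Defs.v *)
From HB Require Import structures.
From mathcomp Require Import all_boot all_order all_algebra ring lra.
From mathcomp Require Import boolp classical_sets reals.

Set Implicit Arguments.
Unset Strict Implicit.
Unset Printing Implicit Defensive.

Import Order.TTheory GRing.Theory Num.Theory.
Local Open Scope ring_scope.

Section Tensors.
Variable R : realType.

Definition scalar_product (u v : 'cV[R]_5) : R := \sum_(i < 5) u i 0 * v i 0.

Definition tensor3 := {ffun 'I_5 * 'I_5 * 'I_5 -> R}.

Implicit Types T U : tensor3.

(* The two transpositions generate the symmetric group on the three slots. *)
Definition symmetric_tensor T : Prop :=
  forall i j k, T (i, j, k) = T (j, i, k) /\ T (i, j, k) = T (i, k, j).

Definition cubic_form T (a : 'cV[R]_5) : R :=
  \sum_(i < 5) \sum_(j < 5) \sum_(k < 5) T (i, j, k) * a i 0 * a j 0 * a k 0.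

(* Indices are shifted by one: the coordinates a_1, ..., a_5 are the entries of
   a in rows 0, ..., 4, where the numerals 0, ..., 4 are elements of 'I_5. *)
Definition standard_cubic (a : 'cV[R]_5) : R :=
  let a1 := a 0 0 in let a2 := a 1 0 in let a3 := a 2 0 in
  let a4 := a 3 0 in let a5 := a 4 0 in
  1 / 2 * a1 * (6 * a2 ^+ 2 + 6 * a4 ^+ 2
                - 2 * a1 ^+ 2 - 3 * a3 ^+ 2 - 3 * a5 ^+ 2)
  + 3 * Num.sqrt 3 / 2 * a4 * (a5 ^+ 2 - a3 ^+ 2)
  + 3 * Num.sqrt 3 * a2 * a3 * a5.

(* This determines U uniquely: see [standard_tensor_exists] and
   [standard_tensor_unique]. *)
Definition is_standard_tensor U : Prop :=
  symmetric_tensor U /\ forall a, cubic_form U a = standard_cubic a.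

Definition orthogonal (H : 'M[R]_5) : Prop := H^T *m H = 1%:M.

(* H^l_i is the entry of H in row l and column i. *)
Definition tensor_act (H : 'M[R]_5) T : tensor3 :=
  [ffun x : 'I_5 * 'I_5 * 'I_5 => let: (i, j, k) := x in
    \sum_(l < 5) \sum_(m < 5) \sum_(n < 5)
      H l i * H m j * H n k * T (l, m, n)].

Definition O5_orbit T : set tensor3 :=
  [set S | exists H, orthogonal H /\ S = tensor_act H T]%classic.

(* The matrix of the endomorphism T_v, that is (T_v)_ij = T_ijk v_k. *)
Definition tensor_endo T (v : 'cV[R]_5) : 'M[R]_5 :=
  \matrix_(i, j) \sum_(k < 5) T (i, j, k) * v k 0.

Lemma tensor_act_symmetric H T :
  symmetric_tensor T -> symmetric_tensor (tensor_act H T).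
Proof.
move=> sT i j k; rewrite !ffunE; split.
  rewrite exchange_big; apply: eq_bigr => l _; apply: eq_bigr => m _.
  by apply: eq_bigr => n _; rewrite (sT m l n).1; ring.
apply: eq_bigr => l _; rewrite exchange_big; apply: eq_bigr => m _.
by apply: eq_bigr => n _; rewrite (sT l n m).2; ring.
Qed.

Lemma standard_tensor_exists : exists U, is_standard_tensor U.
Proof.
pose s : R := Num.sqrt 3.
pose c (x : seq nat) : R :=
  if x == [:: 0; 0; 0]%N then -1 else
  if x == [:: 0; 1; 1]%N then 1 else
  if x == [:: 0; 3; 3]%N then 1 else
  if x == [:: 0; 2; 2]%N then - 1 / 2 else
  if x == [:: 0; 4; 4]%N then - 1 / 2 else
  if x == [:: 3; 4; 4]%N then s / 2 else
  if x == [:: 2; 2; 3]%N then - s / 2 else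
  if x == [:: 1; 2; 4]%N then s / 2 else 0.
pose U : tensor3 := [ffun x : 'I_5 * 'I_5 * 'I_5 => let: (i, j, k) := x in
  c (sort leq [:: val i; val j; val k])].
have sortE (x y : seq nat) : perm_eq x y -> sort leq x = sort leq y.
  by move=> xy; apply/perm_sortP => //;
    [exact: leq_total | exact: leq_trans | exact: anti_leq].
exists U; split=> [i j k|a].
  rewrite !ffunE; split; congr c; apply: sortE.
    by rewrite (perm_catC [:: val i] [:: val j; val k]) /= perm_cons
               (perm_catC [:: val k]).
  by rewrite perm_cons (perm_catC [:: val j]).
have sum5 (F : 'I_5 -> R) : \sum_(i < 5) F i = F 0 + F 1 + F 2 + F 3 + F 4.
  rewrite !big_ord_recl big_ord0 addr0 !addrA.
  by congr (_ + _ + _ + _ + _); congr F; apply: val_inj.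
have cubE i : \sum_(j < 5) \sum_(k < 5) U (i, j, k) * a i 0 * a j 0 * a k 0 =
    a i 0 * \sum_(j < 5) a j 0 * \sum_(k < 5)
      c (sort leq [:: val i; val j; val k]) * a k 0.
  rewrite mulr_sumr; apply: eq_bigr => j _.
  by rewrite !mulr_sumr; apply: eq_bigr => k _; rewrite ffunE; ring.
rewrite /cubic_form (eq_bigr _ (fun i _ => cubE i)) /standard_cubic -/s.
have v0 : val (0 : 'I_5) = 0%N by [].
have v1 : val (1 : 'I_5) = 1%N by [].
have v2 : val (2 : 'I_5) = 2%N by [].
have v3 : val (3 : 'I_5) = 3%N by [].
have v4 : val (4 : 'I_5) = 4%N by [].
rewrite !sum5 v0 v1 v2 v3 v4.
rewrite /c /= !(mul0r, add0r, addr0).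
by field.
Qed.

Lemma standard_tensor_unique U U' :
  is_standard_tensor U -> is_standard_tensor U' -> U = U'.
Proof.
pose t T (a b c : 'cV[R]_5) := \sum_(i < 5) \sum_(j < 5) \sum_(k < 5)
  T (i, j, k) * a i 0 * b j 0 * c k 0.
have tDl T a a' b c : t T (a + a') b c = t T a b c + t T a' b c.
  rewrite /t -big_split; apply: eq_bigr => i _ /=.
  rewrite -big_split; apply: eq_bigr => j _ /=.
  by rewrite -big_split; apply: eq_bigr => k _ /=; rewrite !mxE; ring.
have tC12 T a b c : symmetric_tensor T -> t T a b c = t T b a c.
  move=> sT; rewrite /t exchange_big; apply: eq_bigr => i _.
  apply: eq_bigr => j _; apply: eq_bigr => k _.
  by rewrite (sT j i k).1; ring.
have tC23 T a b c : symmetric_tensor T -> t T a b c = t T a c b.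
  move=> sT; rewrite /t; apply: eq_bigr => i _.
  rewrite exchange_big; apply: eq_bigr => j _; apply: eq_bigr => k _.
  by rewrite (sT i k j).2; ring.
have tE T i j k : T (i, j, k) = t T (delta_mx i 0) (delta_mx j 0) (delta_mx k 0).
  rewrite /t (bigD1 i) //= (bigD1 j) //= (bigD1 k) //= !mxE !eqxx !mulr1.
  rewrite [X in _ = _ + X + _ + _]big1 => [|l /negPf nl]; last first.
    by rewrite !mxE nl mulr0.
  rewrite [X in _ = _ + X + _]big1 => [|l /negPf nl]; last first.
    by rewrite big1 // => m _; rewrite !mxE nl mulr0 mul0r.
  rewrite big1 => [|l /negPf nl]; first by rewrite !addr0.
  by rewrite big1 // => m _; rewrite big1 // => n _; rewrite !mxE nl mulr0 !mul0r.
have polar T a b c : symmetric_tensor T -> 6 * t T a b c =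
    cubic_form T (a + b + c) - cubic_form T (a + b) - cubic_form T (a + c)
    - cubic_form T (b + c) + cubic_form T a + cubic_form T b + cubic_form T c.
  move=> sT; have cE x : cubic_form T x = t T x x x by [].
  have tDm x y y' z : t T x (y + y') z = t T x y z + t T x y' z.
    by rewrite (tC12 T x) // tDl !(tC12 T x).
  have tDr x y z z' : t T x y (z + z') = t T x y z + t T x y z'.
    by rewrite (tC23 T x) // tDm !(tC23 T x y).
  rewrite !cE !tDl !tDm !tDr.
  rewrite (tC23 T a b a) // (tC12 T b a a) // (tC23 T a c a) //
    (tC12 T c a a) // (tC12 T b a b) // (tC23 T b b a) // (tC12 T b a b) //
    (tC23 T b c b) // (tC12 T c b b) // (tC12 T c a c) // (tC23 T c c a) //
    (tC12 T c a c) // (tC12 T c b c) // (tC23 T c c b) // (tC12 T c b c) //.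
  have <- : t T a b c = t T a c b by exact: tC23.
  have <- : t T a b c = t T b a c by exact: tC12.
  have <- : t T a b c = t T b c a by rewrite (tC23 T b) //; exact: tC12.
  have <- : t T a b c = t T c a b by rewrite (tC12 T c) //; exact: tC23.
  have <- : t T a b c = t T c b a.
    by rewrite (tC12 T c) // (tC23 T b) //; exact: tC12.
  by ring.
move=> [sU hU] [sU' hU']; apply/ffunP => -[[i j] k].
apply: (@mulfI _ (6 : R)); first by rewrite pnatr_eq0.
by rewrite !tE !polar // !hU !hU'.
Qed.

End Tensors.

(* Main.v *)
Require Import Defs.
From HB Require Import structures.
From mathcomp Require Import all_boot all_order all_algebra ring lra.
From mathcomp Require Import boolp classical_sets reals.

Set Implicit Arguments.
Unset Strict Implicit.
Unset Printing Implicit Defensive.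

Import Order.TTheory GRing.Theory Num.Theory.
Local Open Scope ring_scope.

(** The theorem says that the three conditions pin down a tensor Psi up to a
change of orthonormal basis. Write x ** y for Psi_x y. Condition (1) makes **
commutative with g(x, y ** z) totally symmetric, (2) says that every
multiplication operator has trace zero, and (3) reads x ** (x ** x) = |x|^2 x.
Such an algebra on R^5 is unique up to isometry, and the tensor is recovered
from the product as g(x, y ** z).

Everything comes from the polarised form of (3), [op_cube_polar]. For a unit
vector v, the plane spanned by v and v ** v is a subalgebra with an explicit
table, and solving one real cubic in it gives a unit vector e with e ** e = - e
([op_anti_idempotent_exists]). Polarising (3) at e shows that the operator
w |-> e ** w is a root of 2L^2 - L - 1 on the complement of e, so its
eigenvalues there are 1 and -1/2. The trace condition ensures that both
eigenspaces E+ and E- are large enough. Choose a unit n in E-. Then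
n ** n + e/2 is a nonzero vector of E+, with normalisation p say; choose a unit
q in E+ orthogonal to p; finally let m be the normalisation of q ** n. Five
orthonormal vectors e, q, m, p, n have been obtained without counting
dimensions, and instances of [op_cube_polar] determine all their products
([op_orthonormal_frame]). No choice is left in the resulting table: it is the
table of the product [standard_product] attached to the standard tensor. The
matrix K with columns e, q, m, p, n is therefore an orthogonal isomorphism of
algebras ([orthogonal_algebra_frame]), and the action of its transpose carries
the standard tensor to Psi.

Conversely the standard cubic determines its tensor by polarisation
([standard_trilinear]), which gives [standard_product] in coordinates; there
the three conditions are polynomial identities, and they are invariant under
conjugation by orthogonal matrices ([endo_act]). *)

(** * The Euclidean space *)

Section ScalarProduct.
Variable R : realType.
Local Notation V := 'cV[R]_5.
Local Notation g := (@scalar_product R).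
Implicit Types (u v w x y z : V) (a b : R).

Lemma sum5 (M : zmodType) (F : 'I_5 -> M) :
  \sum_(i < 5) F i = F 0 + F 1 + F 2 + F 3 + F 4.
Proof.
rewrite !big_ord_recl big_ord0 addr0 !addrA.
by congr (_ + _ + _ + _ + _); congr F; apply: val_inj.
Qed.

Lemma forall_ord5 (P : 'I_5 -> Prop) :
  P 0 -> P 1 -> P 2 -> P 3 -> P 4 -> forall i, P i.
Proof.
move=> P0 P1 P2 P3 P4 [[|[|[|[|[|m]]]]] lt_m] //.
- by have -> : Ordinal lt_m = 0 by exact: val_inj.
- by have -> : Ordinal lt_m = 1 by exact: val_inj.
- by have -> : Ordinal lt_m = 2 by exact: val_inj.
- by have -> : Ordinal lt_m = 3 by exact: val_inj.
- by have -> : Ordinal lt_m = 4 by exact: val_inj.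
Qed.

Lemma sprodC x y : g x y = g y x.
Proof. by apply: eq_bigr => i _; rewrite mulrC. Qed.

Lemma sprodDl x y z : g (x + y) z = g x z + g y z.
Proof. by rewrite -big_split; apply: eq_bigr => i _; rewrite mxE mulrDl. Qed.

Lemma sprodZl a x z : g (a *: x) z = a * g x z.
Proof. by rewrite mulr_sumr; apply: eq_bigr => i _; rewrite mxE mulrA. Qed.

Lemma sprodDr x y z : g z (x + y) = g z x + g z y.
Proof. by rewrite !(sprodC z) sprodDl. Qed.

Lemma sprodZr a x z : g z (a *: x) = a * g z x.
Proof. by rewrite !(sprodC z) sprodZl. Qed.

Lemma sprodNl x z : g (- x) z = - g x z.
Proof. by rewrite -scaleN1r sprodZl mulN1r. Qed.

Lemma sprodNr x z : g z (- x) = - g z x.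
Proof. by rewrite !(sprodC z) sprodNl. Qed.

Lemma sprod0r z : g z 0 = 0.
Proof. by rewrite -(scale0r z) sprodZr mul0r. Qed.

Definition sprodE := (sprodDl, sprodDr, sprodNl, sprodNr, sprodZl, sprodZr).

Lemma sprodM x y : x^T *m y = (g x y)%:M.
Proof.
apply/matrixP => i j; rewrite !ord1 !mxE eqxx mulr1n.
by apply: eq_bigr => k _; rewrite mxE.
Qed.

Lemma sprod_mul (A : 'M[R]_5) x y : g x (A *m y) = g (A^T *m x) y.
Proof.
have : (g x (A *m y))%:M = (g (A^T *m x) y)%:M :> 'M[R]_1.
  by rewrite -!sprodM trmx_mul trmxK mulmxA.
by move/(congr1 (fun M : 'M[R]_1 => M 0 0)); rewrite !mxE eqxx !mulr1n.
Qed.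

Lemma sprod_delta i x : g (delta_mx i 0) x = x i 0.
Proof.
rewrite /scalar_product (bigD1 i) //= mxE !eqxx mul1r big1 ?addr0 // => j.
by move=> /negPf nj; rewrite mxE nj mul0r.
Qed.

Lemma sprod_inj x y : (forall u, g u x = g u y) -> x = y.
Proof. by move=> xy; apply/colP => i; rewrite -!sprod_delta. Qed.

Lemma sprod_eq0 x : g x x = 0 -> x = 0.
Proof.
move=> x0; apply/colP => i; rewrite mxE; apply/eqP; rewrite -sqrf_eq0 expr2.
have /psumr_eq0P-> // : \sum_(i < 5) x i 0 * x i 0 = 0 by [].
by move=> j _; rewrite -expr2 sqr_ge0.
Qed.

Lemma sprod_ge0 x : 0 <= g x x.
Proof. by apply: sumr_ge0 => j _; rewrite -expr2 sqr_ge0. Qed.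

Lemma unit_multiple x : x <> 0 -> exists a, g (a *: x) (a *: x) = 1.
Proof.
move=> x0; have xx : 0 < g x x.
  by rewrite lt_def sprod_ge0 andbT; apply/eqP => /sprod_eq0.
exists (Num.sqrt (g x x))^-1; rewrite !sprodE mulrA -expr2 exprVn.
by rewrite sqr_sqrtr ?ltW // mulVf // gt_eqF.
Qed.

Lemma mxtrace_outer x y : \tr (x *m y^T) = g x y.
Proof. by rewrite mxtrace_mulC sprodM mxtrace_scalar sprodC. Qed.

Lemma outer_mul x y w : x *m y^T *m w = g y w *: x.
Proof. by rewrite -mulmxA sprodM mul_mx_scalar. Qed.

Lemma col_sum x : x = \sum_i x i 0 *: delta_mx i 0.
Proof.
apply/colP => i; rewrite summxE (bigD1 i) //= !mxE !eqxx mulr1 big1 ?addr0 //.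
by move=> j /negPf nj; rewrite !mxE eq_sym nj mulr0.
Qed.

Lemma eq_mulmx (A B : 'M[R]_5) : (forall w : V, A *m w = B *m w) -> A = B.
Proof.
move=> AB; apply/matrixP => i j.
by have /colP/(_ i) := AB (delta_mx j 0); rewrite -!colE !mxE.
Qed.

(** This is how the trace condition produces eigenvectors: a matrix whose image
consists of eigenvectors has a nonzero image once its trace is nonzero. *)
Lemma trace_neq0_image (A : 'M[R]_5) : \tr A != 0 -> exists w, A *m w <> 0.
Proof.
move=> trA; apply: contrapT => /forallNP A0.
suff A00 : A = 0 by rewrite A00 mxtrace0 eqxx in trA.
by apply: eq_mulmx => w; rewrite mul0mx; exact: contrapT (A0 w).
Qed.

End ScalarProduct.

(** A linear consequence of vector equations can be checked entrywise, where
each entry of a product of vectors is an atom for linear arithmetic. *)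
Ltac by_coordinates :=
  let i := fresh "i" in
  intros; apply/colP => i;
  repeat match goal with
  | H : _ = _ |- _ =>
      move/colP/(_ i): H; rewrite ?mxE => H
  end;
  rewrite ?mxE; lra.

(** * Products with x ** (x ** x) = |x|^2 x *)

Section CubicProduct.
Variable R : realType.
Local Notation V := 'cV[R]_5.
Local Notation g := (@scalar_product R).
Local Notation s := (Num.sqrt 3 : R).
Implicit Types (u v w x y z : V) (a b : R).

Variable op : V -> V -> V.
Local Notation "x ** y" := (op x y) (at level 40, left associativity).

Hypothesis opC : forall x y, x ** y = y ** x.
Hypothesis opDr : forall x y z, x ** (y + z) = x ** y + x ** z.
Hypothesis opZr : forall a x y, x ** (a *: y) = a *: (x ** y).
Hypothesis sprod_op : forall x y z, g x (y ** z) = g (y ** x) z.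
Hypothesis op_cube : forall x, x ** (x ** x) = g x x *: x.
(* The product is a bare function, so that by_coordinates treats its entries as
   atoms; the trace of w |-> x ** w is taken through any matrix representing it. *)
Hypothesis op_trace : forall x (M : 'M[R]_5),
  (forall w, M *m w = x ** w) -> \tr M = 0.

Lemma opDl x y z : (x + y) ** z = x ** z + y ** z.
Proof. by rewrite !(opC _ z) opDr. Qed.

Lemma opZl a x y : (a *: x) ** y = a *: (x ** y).
Proof. by rewrite !(opC _ y) opZr. Qed.

Lemma opNr x y : x ** (- y) = - (x ** y).
Proof. by rewrite -scaleN1r opZr scaleN1r. Qed.

Lemma opNl x y : (- x) ** y = - (x ** y).
Proof. by rewrite !(opC _ y) opNr. Qed.

Lemma op0r x : x ** 0 = 0.
Proof. by rewrite -(scale0r x) opZr !scale0r. Qed.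

Definition opE := (opDl, opDr, opNl, opNr, opZl, opZr).

(** The part of x ** (x ** x) = |x|^2 x that is linear in each of three
variables; it is the source of the multiplication table found below. *)
Lemma op_cube_polar x y z :
  x ** (y ** z) + y ** (z ** x) + z ** (x ** y) =
  g y z *: x + g z x *: y + g x y *: z.
Proof.
have := op_cube (x + y + z); have := op_cube (x + y); have := op_cube (x + z).
have := op_cube (y + z); have := op_cube x; have := op_cube y.
have := op_cube z; rewrite !opE !sprodE.
rewrite (opC y x) (opC z x) (opC z y) (sprodC y x) (sprodC z x) (sprodC z y).
by_coordinates.
Qed.

Lemma op_square_polar x w :
  2 *: (x ** (x ** w)) + w ** (x ** x) = (2 * g x w) *: x + g x x *: w.
Proof.
have := op_cube_polar x x w; rewrite (opC w x) (sprodC w x).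
by_coordinates.
Qed.

Lemma op_square_norm x : g x x = 1 -> g (x ** x) (x ** x) = 1.
Proof. by move=> xx; rewrite -sprod_op op_cube sprodE xx mulr1. Qed.

Lemma op_matrix x :
  exists M : 'M[R]_5, (forall w, M *m w = x ** w) /\ \tr M = 0.
Proof.
have [M ME] : exists M : 'M[R]_5, forall w, M *m w = x ** w.
  exists (\matrix_(i, j) (x ** delta_mx j 0) i 0) => w.
  rewrite [in RHS](col_sum w) sum5 !opE.
  by apply/colP => i; rewrite !mxE sum5 !mxE; ring.
by exists M; split=> //; exact: op_trace ME.
Qed.

(** On the plane spanned by a unit vector v and u = v ** v the table is
v ** v = u, v ** u = v, u ** u = 2 c v - u with c = g(v, u). For e = x v + y u
the equation e ** e = - e reads x (2 y + 1) = - 2 c y^2 and x^2 = y^2 - y.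
Eliminating x leaves 4 (1 - c^2) y^3 - 3 y - 1 = 0, a cubic with a root in
[1, 1 / (1 - c^2)] when c^2 < 1; y >= 1 makes y^2 - y a square. If c^2 = 1 then
v and u are proportional and - c v works. *)
Lemma op_anti_idempotent_exists : exists e, e ** e = - e /\ g e e = 1.
Proof.
(* A nonzero solution is automatically a unit vector: by the cube identity
   |e|^2 e = e ** (e ** e) = e. *)
have unit_e e : e ** e = - e -> e <> 0 -> g e e = 1.
  move=> ee e0; have := op_cube e; rewrite ee !opE ee opprK => eE.
  have : (g e e - 1) *: e = 0 by rewrite scalerBl scale1r -eE subrr.
  by move/eqP; rewrite scaler_eq0 => /orP[/eqP|/eqP //]; lra.
pose v : V := delta_mx 0 0.
have vv : g v v = 1 by rewrite sprod_delta mxE !eqxx.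
pose u := v ** v; pose c := g v u.
have uu : g u u = 1 by exact: op_square_norm.
have vu : v ** u = v by rewrite op_cube vv scale1r.
have uuE : u ** u = (2 * c) *: v - u.
  have := op_square_polar v u; rewrite -/u vu vv -/c -/u; by_coordinates.
have dist a : g (u - a *: v) (u - a *: v) = 1 - 2 * a * c + a ^+ 2.
  rewrite !sprodE uu vv (sprodC u v) -/c; ring.
have c2_le1 : c ^+ 2 <= 1 by have := sprod_ge0 (u - c *: v); rewrite dist; lra.
have [c2|c2_neq1] := eqVneq (c ^+ 2) 1.
  have uE : u = c *: v.
    apply: subr0_eq; apply: sprod_eq0; rewrite dist; lra.
  exists (- c *: v); split; last by rewrite !sprodE vv; lra.
  by rewrite !opE -/u uE !scalerA -scaleNr; congr (_ *: _); ring: c2.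
have d_gt0 : 0 < 1 - c ^+ 2 by rewrite subr_gt0 lt_neqAle c2_neq1.
set d := 1 - c ^+ 2 in d_gt0.
pose h : {poly R} := (4 * d) *: 'X^3 - 3 *: 'X - 1%:P.
have hE t : h.[t] = 4 * d * t ^+ 3 - 3 * t - 1 by rewrite !hornerE.
have d_le1 : d <= 1 by rewrite /d; have := sqr_ge0 c; lra.
have dV : 1 <= d^-1 by rewrite invf_ge1.
have [|y /andP[y1 _] /rootP] := @poly_ivt _ h 1 d^-1 dV.
  rewrite !hE; apply/andP; split; first lra.
  have -> : 4 * d * d^-1 ^+ 3 - 3 * d^-1 - 1 = (4 + d) * (1 - d) / d ^+ 2.
    by field; rewrite gt_eqF.
  by rewrite divr_ge0 ?sqr_ge0 // mulr_ge0; lra.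
rewrite hE => hy.
pose x := - 2 * c * y ^+ 2 / (2 * y + 1).
have y2 : 2 * y + 1 != 0 by rewrite gt_eqF; lra.
have xy : x * (2 * y + 1) = - 2 * c * y ^+ 2 by rewrite /x divfK.
have xx : x ^+ 2 = y ^+ 2 - y.
  apply: (@mulIf _ ((2 * y + 1) ^+ 2)); first by rewrite expf_neq0.
  rewrite -exprMn xy.
  have hc : c ^+ 2 = 1 - d by rewrite /d; ring.
  transitivity (4 * (1 - d) * y ^+ 4); first by rewrite -hc; ring.
  have : y * (4 * d * y ^+ 3 - 3 * y - 1) = 0 by rewrite hy mulr0.
  lra.
pose e := x *: v + y *: u.
have ee : e ** e = - e.
  rewrite /e !opE -/u (opC u v) vu uuE.
  have : (x ^+ 2 - y ^+ 2 + y) *: u = 0.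
    by rewrite xx [X in X *: _](_ : _ = 0) ?scale0r //; ring.
  have : (x * (2 * y + 1) + 2 * c * y ^+ 2) *: v = 0.
    by rewrite xy [X in X *: _](_ : _ = 0) ?scale0r //; ring.
  by_coordinates.
(* If e = 0 then u is a multiple of v, which forces c^2 = 1. *)
exists e; split=> //; apply: unit_e => // e0.
have uE : u = (- x / y) *: v.
  apply: (@scalerI _ _ y); first by rewrite gt_eqF; lra.
  rewrite scalerA mulrC divfK; last by rewrite gt_eqF; lra.
  by apply/eqP; rewrite scaleNr -addr_eq0 addrC; apply/eqP.
have cE : c = - x / y by rewrite /c uE sprodE vv mulr1.
by move: c2_neq1; rewrite -uu uE !sprodE -cE vv mulr1 expr2 eqxx.
Qed.

(** The vectors are listed in the order of the coordinates a_1, ..., a_5 of the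
standard cubic: for instance the term 3 a_1 a_2^2 comes from g(e, q ** q) = 1,
and 3 s a_2 a_3 a_5 from g(n, q ** m) = s / 2. In the proof they arise in the
order e, n, p, q, m. *)
Lemma op_orthonormal_frame : exists e q m p n,
 [/\ [/\ g e e = 1, g q q = 1, g m m = 1, g p p = 1 & g n n = 1],
     [/\ g e q = 0, g e m = 0, g e p = 0 & g e n = 0],
     [/\ g q m = 0, g q p = 0 & g q n = 0],
     [/\ g m p = 0, g m n = 0 & g p n = 0] &
  [/\ [/\ e ** e = - e, e ** q = q, e ** m = - 2^-1 *: m, e ** p = p &
        e ** n = - 2^-1 *: n],
     [/\ q ** q = e, q ** m = (s / 2) *: n, q ** p = 0 &
        q ** n = (s / 2) *: m],
     [/\ m ** m = - 2^-1 *: e - (s / 2) *: p, m ** p = - (s / 2) *: m &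
        m ** n = (s / 2) *: q],
     [/\ p ** p = e & p ** n = (s / 2) *: n] &
     n ** n = - 2^-1 *: e + (s / 2) *: p]].
Proof.
have ss : s * s = 3 by rewrite -expr2 sqr_sqrtr.
have [e [ee e1]] := op_anti_idempotent_exists.
(* The operator w |-> e ** w satisfies 2 L^2 - L - 1 = 0 up to a multiple of
   e, so the orthogonal complement of e splits into eigenspaces for 1 and -1/2;
   these are orthogonal to each other because L is self-adjoint. *)
have Le2 w : e ** (e ** w) = 2^-1 *: (e ** w) + g e w *: e + 2^-1 *: w.
  have := op_square_polar e w; rewrite ee e1 opNr (opC w e); by_coordinates.
have ge_op x w : g x (e ** w) = g (e ** x) w by exact: sprod_op.
have orth_p x : e ** x = x -> g e x = 0.
  by move=> ex; have := ge_op e x; rewrite ex ee sprodE; lra.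
have orth_n x : e ** x = - 2^-1 *: x -> g e x = 0.
  by move=> ex; have := ge_op e x; rewrite ex ee !sprodE; lra.
have orth_pn x y : e ** x = x -> e ** y = - 2^-1 *: y -> g x y = 0.
  by move=> ex ey; have := ge_op x y; rewrite ex ey !sprodE; lra.
(* -2 is not an eigenvalue of L. The polarised identity puts the vectors
   q ** q - e, p ** p - e and q ** p below in the eigenspace for -2. *)
have no_m2 x : e ** x = - 2 *: x -> x = 0.
  move=> ex; have := Le2 x; rewrite ex opZr ex => xE.
  have ge : g e x = 0.
    by have := congr1 (g e) xE; rewrite !sprodE e1; lra.
  by move: xE; rewrite ge; by_coordinates.
have [Le [LeE Letr]] := op_matrix e.
(* 1 - L - 2 e e^T kills e and E+ and is 3/2 on E-; its trace is 5 - 2 = 3. *)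
have [n [en n1]] : exists n, e ** n = - 2^-1 *: n /\ g n n = 1.
  have [|w /unit_multiple[a]] :=
      @trace_neq0_image _ (1%:M - Le - 2 *: (e *m e^T)).
    rewrite !raddfB /= linearZ /= Letr mxtrace_outer e1 mxtrace_scalar; lra.
  rewrite !mulmxBl -scalemxAl outer_mul mul1mx LeE.
  set x := (X in a *: X) => x1; exists (a *: x); split=> //.
  rewrite opZr scalerA mulrC -scalerA; congr (_ *: _).
  by rewrite /x !opE ee Le2; by_coordinates.
have en0 := orth_n n en.
(* n ** n has component -1/2 along e and the rest of it lies in E+. As n ** n is
   a unit vector, that rest has norm s / 2, the inverse of 2 s / 3. *)
(* The equation hides the definition of p from rewriting by linearity, which
   would otherwise see through p as a multiple of another vector. *)
have [p pE] : exists p, p = (2 * s / 3) *: (n ** n + 2^-1 *: e) by eexists.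
have enn : e ** (n ** n) = n ** n + e.
  have := op_cube_polar e n n; rewrite (opC n e) en n1 (sprodC n e) en0 !opE.
  by_coordinates.
have ep : e ** p = p by rewrite pE !opE enn ee; by_coordinates.
have nnE : n ** n = - 2^-1 *: e + (s / 2) *: p.
  have : (s / 2) *: p = n ** n + 2^-1 *: e.
    by rewrite pE scalerA (_ : s / 2 * _ = 1) ?scale1r //; lra.
  by_coordinates.
have pn : p ** n = (s / 2) *: n.
  rewrite (opC p) pE !opE op_cube n1 (opC n e) en !scalerA -scalerDl scalerA.
  by congr (_ *: _); lra.
have ep0 := orth_p p ep; have pn0 := orth_pn p n ep en.
have p1 : g p p = 1.
  have := op_square_norm n1; rewrite nnE !sprodE e1 ep0 (sprodC p e) ep0 => h.
  have : s * s / 4 * g p p = 3 / 4 by move: h; lra.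
  by rewrite ss; lra.
(* L + 1/2 + e e^T / 2 kills e and E- and is 3/2 on E+; subtracting 3/2 of the
   projection to p leaves the part of E+ orthogonal to p. The trace is
   5/2 + 1/2 - 3/2 = 3/2. *)
have [q [eq qp0 q1]] : exists q, [/\ e ** q = q, g q p = 0 & g q q = 1].
  have [|w /unit_multiple[a]] := @trace_neq0_image _
      (Le + 2^-1%:M + 2^-1 *: (e *m e^T) - (3 / 2) *: (p *m p^T)).
    rewrite raddfB !raddfD /= !linearZ /= Letr !mxtrace_outer e1 p1.
    by rewrite mxtrace_scalar; lra.
  rewrite mulmxBl !mulmxDl -!scalemxAl !outer_mul mul_scalar_mx LeE.
  set x := (X in a *: X) => x1; exists (a *: x); split=> //.
    rewrite opZr; congr (_ *: _).
    by rewrite /x !opE ee Le2 ep; by_coordinates.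
  rewrite sprodZl sprodC /x !sprodE ge_op ep (sprodC p e) ep0 p1.
  by field.
have eq0 := orth_p q eq; have qn0 := orth_pn q n eq en.
have qq : q ** q = e.
  apply: subr0_eq; apply: no_m2; rewrite !opE ee.
  have := op_cube_polar e q q; rewrite (opC q e) eq q1 (sprodC q) eq0.
  by_coordinates.
have qp : q ** p = 0.
  apply: no_m2; have := op_cube_polar e q p.
  rewrite (opC p e) eq ep (sprodC p) qp0 ep0 eq0 (opC p q); by_coordinates.
have pp : p ** p = e.
  apply: subr0_eq; apply: no_m2; rewrite !opE ee.
  have := op_cube_polar e p p; rewrite (opC p e) ep p1 (sprodC p) ep0.
  by_coordinates.
(* Multiplication by q preserves E- and squares to 3/4 there, so m is a unit
   vector. On E- it anticommutes with multiplication by p, as q ** p = 0, so the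
   latter has eigenvalue - s / 2 at m since it has s / 2 at n. *)
have [m mE] : exists m, m = (2 * s / 3) *: (q ** n) by eexists.
have qn : q ** n = (s / 2) *: m.
  by rewrite mE scalerA (_ : s / 2 * _ = 1) ?scale1r //; lra.
have qqn : q ** (q ** n) = (3 / 4) *: n.
  have := op_square_polar q n; rewrite qq (opC n e) en qn0 q1; by_coordinates.
have qm : q ** m = (s / 2) *: n.
  by rewrite mE opZr qqn scalerA; congr (_ *: _); field.
have em : e ** m = - 2^-1 *: m.
  have eqn : e ** (q ** n) = - 2^-1 *: (q ** n).
    have := op_cube_polar e q n; rewrite (opC n e) en eq opZr (opC n q).
    by rewrite qn0 (sprodC n) en0 eq0; by_coordinates.
  by rewrite mE opZr eqn !scalerA mulrC.
have m1 : g m m = 1.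
  rewrite mE !sprodE -sprod_op qqn sprodE n1; lra.
have mp : m ** p = - (s / 2) *: m.
  have : p ** (q ** n) = - (s / 2) *: (q ** n).
    have := op_cube_polar p q n; rewrite (opC p q) qp (opC n p) pn !opE.
    rewrite qn0 (sprodC n) pn0 (sprodC p) qp0.
    by rewrite op0r; by_coordinates.
  rewrite (opC m) mE opZr => ->; rewrite !scalerA; congr (_ *: _); ring.
have mn : m ** n = (s / 2) *: q.
  rewrite (opC m) mE opZr.
  have := op_cube_polar q n n; rewrite (opC n q) nnE n1 (sprodC n) qn0 !opE.
  rewrite qp (opC q e) eq => h.
  have -> : n ** (q ** n) = (3 / 4) *: q by move: h; by_coordinates.
  by rewrite scalerA; congr (_ *: _); field.
have em0 := orth_n m em; have qm0 := orth_pn q m eq em.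
have mp0 : g m p = 0 by rewrite sprodC; exact: orth_pn.
(* Different eigenvalues for the multiplication by p. *)
have mn0 : g m n = 0.
  have := sprod_op m p n; rewrite pn (opC p) mp !sprodE => h.
  have : s * s * g m n = 0 by rewrite -mulrA (_ : s * g m n = 0) ?mulr0 //; lra.
  by rewrite ss; lra.
have mm : m ** m = - 2^-1 *: e - (s / 2) *: p.
  have := op_cube_polar q n m; rewrite (opC m q) qm qn !opE (opC n m) mn opZr.
  rewrite nnE qq (sprodC n m) mn0 (sprodC m q) qm0 qn0 => h.
  have : (s * s) *: (m ** m) = (s * s) *: (- 2^-1 *: e - (s / 2) *: p).
    by rewrite -!scalerA; congr (_ *: _); move: h; by_coordinates.
  by rewrite ss; move/scalerI; apply; rewrite pnatr_eq0.
by exists e, q, m, p, n.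
Qed.

End CubicProduct.

(** * The standard product *)

Section StandardProduct.
Variable R : realType.
Local Notation V := 'cV[R]_5.
Local Notation g := (@scalar_product R).
Local Notation s := (Num.sqrt 3 : R).

(** The polarisation of one third of the gradient of the standard cubic, that
is, the product (x, y) |-> Upsilon_x y in coordinates. *)
Definition standard_product (x y : V) : V := \col_(i < 5)
  (let x1 := x 0 0 in let x2 := x 1 0 in let x3 := x 2 0 in
   let x4 := x 3 0 in let x5 := x 4 0 in
   let y1 := y 0 0 in let y2 := y 1 0 in let y3 := y 2 0 in
   let y4 := y 3 0 in let y5 := y 4 0 in
   [:: - (x1 * y1) + x2 * y2 + x4 * y4 - (x3 * y3 + x5 * y5) / 2;
       x1 * y2 + x2 * y1 + s / 2 * (x3 * y5 + x5 * y3);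
       - (x1 * y3 + x3 * y1) / 2
         + s / 2 * (x2 * y5 + x5 * y2 - x4 * y3 - x3 * y4);
       x1 * y4 + x4 * y1 + s / 2 * (x5 * y5 - x3 * y3);
       - (x1 * y5 + x5 * y1) / 2
         + s / 2 * (x2 * y3 + x3 * y2 + x4 * y5 + x5 * y4)])`_i.

Lemma standard_product_cube x :
  standard_product x (standard_product x x) = g x x *: x.
Proof.
have ss : s * s = 3 by rewrite -expr2 sqr_sqrtr.
by apply/colP; apply: forall_ord5;
  rewrite /scalar_product sum5 !mxE /=; field: ss.
Qed.

Lemma standard_product_trace x :
  \sum_i standard_product x (delta_mx i 0) i 0 = 0.
Proof. by rewrite sum5 !mxE /=; field. Qed.

(** The uniqueness half of the theorem: in the coordinates given by a suitable
orthonormal frame, every such product is the standard one. *)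
Lemma orthogonal_algebra_frame (op : V -> V -> V) :
  (forall x y, op x y = op y x) ->
  (forall x y z, op x (y + z) = op x y + op x z) ->
  (forall a x y, op x (a *: y) = a *: op x y) ->
  (forall x y z, g x (op y z) = g (op y x) z) ->
  (forall x, op x (op x x) = g x x *: x) ->
  (forall x (M : 'M[R]_5), (forall w, M *m w = op x w) -> \tr M = 0) ->
  exists K : 'M[R]_5, K^T *m K = 1%:M /\
    forall x y, op (K *m x) (K *m y) = K *m standard_product x y.
Proof.
move=> opC opDr opZr sop opcube optr.
have [e [q [m [p [n [nrm [eq em ep en] [qm qp qn] [mp mn pn]]]]]]] :=
  op_orthonormal_frame opC opDr opZr sop opcube optr.
case: nrm => e1 q1 m1 p1 n1.
case=> [[ee0 eq0 em0 ep0 en0] [qq0 qm0 qp0 qn0] [mm0 mp0 mn0] [pp0 pn0] nn0].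
pose f (j : 'I_5) := [:: e; q; m; p; n]`_j.
pose K : 'M[R]_5 := \matrix_(i, j) f j i 0.
have KE x : K *m x =
    x 0 0 *: e + x 1 0 *: q + x 2 0 *: m + x 3 0 *: p + x 4 0 *: n.
  by apply/colP => i; rewrite !mxE sum5 !mxE /=; ring.
exists K; split=> [|x y].
  have KTK i j : (K^T *m K) i j = g (f i) (f j).
    by rewrite mxE; apply: eq_bigr => k _; rewrite !mxE.
  apply/matrixP => i j; rewrite KTK mxE; move: i j.
  by apply: forall_ord5; apply: forall_ord5; rewrite /f /= // sprodC.
rewrite !KE.
rewrite !(opDl opC opDr, opDr, opZl opC opZr, opZr).
rewrite (opC q e) (opC m e) (opC p e) (opC n e) (opC m q) (opC p q) (opC n q).
rewrite (opC p m) (opC n m) (opC n p).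
rewrite ee0 eq0 em0 ep0 en0 qq0 qm0 qp0 qn0 mm0 mp0 mn0 pp0 pn0 nn0.
by apply/colP => i; rewrite !mxE /=; field.
Qed.

End StandardProduct.

(** * Tensors as trilinear forms *)

Section Trilinear.
Variable R : realType.
Local Notation V := 'cV[R]_5.
Local Notation g := (@scalar_product R).
Implicit Types (T U : tensor3 R) (u v w x y z : V).

Definition trilinear T x y z : R :=
  \sum_(i < 5) \sum_(j < 5) \sum_(k < 5) T (i, j, k) * x i 0 * y j 0 * z k 0.

Lemma sprod_endo T u v w : g u (tensor_endo T v *m w) = trilinear T u w v.
Proof.
apply: eq_bigr => i _; rewrite mxE mulr_sumr; apply: eq_bigr => j _.
rewrite mxE mulr_suml mulr_sumr; apply: eq_bigr => k _; ring.
Qed.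

Lemma trilinear_delta T i j k :
  trilinear T (delta_mx i 0) (delta_mx j 0) (delta_mx k 0) = T (i, j, k).
Proof.
rewrite -sprod_endo sprod_delta -colE !mxE (bigD1 k) //= mxE !eqxx mulr1.
by rewrite big1 ?addr0 // => l /negPf nl; rewrite mxE nl mulr0.
Qed.

Lemma tensor_eq T U :
  (forall x y z, trilinear T x y z = trilinear U x y z) -> T = U.
Proof. by move=> TU; apply/ffunP => -[[i j] k]; rewrite -!trilinear_delta. Qed.

Lemma endo_linear T a x y :
  tensor_endo T (a *: x + y) = a *: tensor_endo T x + tensor_endo T y.
Proof.
apply/matrixP => i j; rewrite !mxE mulr_sumr -big_split; apply: eq_bigr => k _.
by rewrite !mxE /=; ring.
Qed.

Lemma trilinear_sum T (I J L : finType) (a : I -> R) (b : J -> R) (c : L -> R)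
    (x : I -> V) (y : J -> V) (z : L -> V) :
  trilinear T (\sum_i a i *: x i) (\sum_j b j *: y j) (\sum_k c k *: z k) =
  \sum_i \sum_j \sum_k trilinear T (x i) (y j) (z k) * a i * b j * c k.
Proof.
have g_sum I' (u : V) (F : I' -> V) r :
    g u (\sum_(i <- r) F i) = \sum_(i <- r) g u (F i).
  exact: (big_morph (g u) (fun v v' => sprodDr v v' u) (sprod0r u)).
have lin1 v w : trilinear T (\sum_i a i *: x i) v w =
    \sum_i a i * trilinear T (x i) v w.
  rewrite -sprod_endo sprodC g_sum.
  by apply: eq_bigr => i _; rewrite sprodZr sprodC sprod_endo.
have lin2 u w : trilinear T u (\sum_j b j *: y j) w =
    \sum_j b j * trilinear T u (y j) w.
  rewrite -sprod_endo mulmx_sumr g_sum.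
  by apply: eq_bigr => j _; rewrite -scalemxAr sprodZr sprod_endo.
have lin3 u v : trilinear T u v (\sum_k c k *: z k) =
    \sum_k c k * trilinear T u v (z k).
  have addT w w' :
      trilinear T u v (w + w') = trilinear T u v w + trilinear T u v w'.
    rewrite -!sprod_endo -[w in w + w']scale1r endo_linear scale1r.
    by rewrite mulmxDl sprodDr.
  have T0 : trilinear T u v 0 = 0.
    by apply: (addrI (trilinear T u v 0)); rewrite -addT !addr0.
  rewrite (big_morph _ addT T0); apply: eq_bigr => k _.
  rewrite -!sprod_endo -[c k *: _]addr0 endo_linear mulmxDl sprodDr.
  by rewrite -scalemxAl sprodZr !sprod_endo T0 addr0.
rewrite lin1; apply: eq_bigr => i _.
rewrite lin2 mulr_sumr; apply: eq_bigr => j _.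
by rewrite lin3 !mulr_sumr; apply: eq_bigr => k _; ring.
Qed.

(** The action on tensors is substitution in trilinear forms. *)
Lemma trilinear_act H T x y z :
  trilinear (tensor_act H T) x y z = trilinear T (H *m x) (H *m y) (H *m z).
Proof.
have mulE v : H *m v = \sum_i v i 0 *: col i H.
  rewrite [in LHS](col_sum v) mulmx_sumr; apply: eq_bigr => i _.
  by rewrite -scalemxAr -colE.
rewrite !mulE trilinear_sum.
apply: eq_bigr => i _; apply: eq_bigr => j _; apply: eq_bigr => k _.
rewrite ffunE; do 3 congr (_ * _).
apply: eq_bigr => l _; apply: eq_bigr => m _; apply: eq_bigr => n _.
by rewrite !mxE; ring.
Qed.

Lemma endo_act H T v :
  tensor_endo (tensor_act H T) v = H^T *m tensor_endo T (H *m v) *m H.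
Proof.
apply: eq_mulmx => w; apply: sprod_inj => u.
by rewrite sprod_endo trilinear_act -!mulmxA sprod_mul trmxK sprod_endo.
Qed.

Lemma polarization (F : V -> V -> V -> R) x y z :
    (forall x x' y z, F (x + x') y z = F x y z + F x' y z) ->
    (forall x y z, F x y z = F y x z) ->
    (forall x y z, F x y z = F x z y) ->
  let P v := F v v v in
  6 * F x y z = P (x + y + z) - P (x + y) - P (x + z) - P (y + z)
                + P x + P y + P z.
Proof.
move=> F1 F12 F23 P.
have F2 u v v' w : F u (v + v') w = F u v w + F u v' w.
  by rewrite F12 F1 !(F12 u).
have F3 u v w w' : F u v (w + w') = F u v w + F u v w'.
  by rewrite F23 F2 !(F23 u v).
have uvu u v : F u v u = F u u v by exact: F23.
have vuu u v : F v u u = F u u v by rewrite F12 uvu.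
rewrite /P !(F1, F2, F3).
rewrite !(uvu x y, vuu x y, uvu y x, vuu y x, uvu x z, vuu x z).
rewrite !(uvu z x, vuu z x, uvu y z, vuu y z, uvu z y, vuu z y).
rewrite (F23 x z y) (F12 y x z) (F23 y z x) (F12 y x z).
rewrite (F12 z x y) (F23 x z y) (F23 z y x) (F12 z x y) (F23 x z y).
ring.
Qed.

(** A symmetric trilinear form is determined by its values on the diagonal, and
both sides restrict to the standard cubic there. *)
Lemma standard_trilinear U x y z : is_standard_tensor U ->
  trilinear U x y z = g x (standard_product y z).
Proof.
case=> symU cubU; apply: (@mulfI _ (6 : R)); first by rewrite pnatr_eq0.
rewrite polarization; last first.
- move=> u v w; apply: eq_bigr => i _; rewrite exchange_big.
  by apply: eq_bigr => j _; apply: eq_bigr => k _; rewrite (symU i k j).2; ring.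
- move=> u v w; rewrite /trilinear exchange_big; apply: eq_bigr => i _.
  by apply: eq_bigr => j _; apply: eq_bigr => k _; rewrite (symU j i k).1; ring.
- by move=> u u' v w; rewrite -!sprod_endo sprodDl.
have diagE v : trilinear U v v v = standard_cubic v by rewrite -cubU.
rewrite !diagE /standard_cubic /scalar_product sum5 !mxE /=.
by field.
Qed.

Lemma standard_endo U x y : is_standard_tensor U ->
  tensor_endo U x *m y = standard_product x y.
Proof.
move=> stU; apply: sprod_inj => u; rewrite sprod_endo standard_trilinear //.
by congr (g u _); apply/colP; apply: forall_ord5; rewrite !mxE /=; ring.
Qed.

End Trilinear.

Theorem theorem2p6 (R : realType) (Upsilon : tensor3 R)
    (hUpsilon : is_standard_tensor Upsilon) :
  O5_orbit Upsilon =
  [set Psi : tensor3 R |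
    [/\ (forall u v w : 'cV[R]_5,
           scalar_product u (tensor_endo Psi v *m w)
             = scalar_product w (tensor_endo Psi v *m u)
           /\ scalar_product w (tensor_endo Psi v *m u)
             = scalar_product u (tensor_endo Psi w *m v)),
        (forall v : 'cV[R]_5, \tr (tensor_endo Psi v) = 0)
      & (forall v : 'cV[R]_5,
           tensor_endo Psi v ^+ 2 *m v = scalar_product v v *: v)]]%classic.
Proof.
have stdC x y : standard_product x y = standard_product y x :> 'cV[R]_5.
  by apply/colP; apply: forall_ord5; rewrite !mxE /=; ring.
have stdS x y z : scalar_product x (standard_product y z) =
                  scalar_product z (standard_product y x) :> R.
  by rewrite /scalar_product !sum5 !mxE /=; field.
apply/seteqP; split=> [_ [H [HH ->]] | Psi [sym tr cube]].
  have HH' : H *m H^T = 1%:M by exact: mulmx1C.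
  split=> [u v w|v|v].
  - rewrite !sprod_endo !trilinear_act !standard_trilinear //.
    rewrite (stdC (H *m w)) (stdC (H *m u)).
    by rewrite (stdS (H *m w)).
  - rewrite endo_act mxtrace_mulC mulmxA HH' mul1mx.
    rewrite -[RHS](standard_product_trace (H *m v)).
    apply: eq_bigr => i _.
    by rewrite -(standard_endo _ _ hUpsilon) -colE [RHS]mxE.
  - rewrite expr2 -mulmxE endo_act -!mulmxA (mulmxA H) HH' mul1mx.
    rewrite !standard_endo // standard_product_cube -scalemxAr mulmxA HH mul1mx.
    by rewrite sprod_mul mulmxA HH mul1mx.
pose op (x y : 'cV[R]_5) := tensor_endo Psi x *m y.
have opC x y : op x y = op y x.
  apply: sprod_inj => u; rewrite /op.
  by have [-> ->] := sym u x y.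
have [|||||K [KK KE]] := @orthogonal_algebra_frame R op opC.
- by move=> x y z; rewrite /op mulmxDr.
- by move=> a x y; rewrite /op -scalemxAr.
- move=> x y z; rewrite (sprodC (op y x)); exact: (sym x y z).1.
- by move=> x; rewrite -cube expr2 -mulmxE -mulmxA.
- move=> x M ME; rewrite -(tr x); congr (\tr _).
  exact: eq_mulmx.
exists K^T; split; first by rewrite /Defs.orthogonal trmxK; exact: mulmx1C.
have KK' : K *m K^T = 1%:M by exact: mulmx1C.
apply: tensor_eq => x y z.
have KKt v : v = K *m (K^T *m v) by rewrite mulmxA KK' mul1mx.
rewrite trilinear_act (standard_trilinear _ _ _ hUpsilon) stdC.
by rewrite -sprod_mul -KE -!KKt sprod_endo.
Qed.
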